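(* There exist constants $\delta_1,\delta_2,\delta_3>0$ such that the following holds. For any positive integers $n,d$ and any $(n,d,\lambda)$-graph $G$ such that $d\le \delta_3 n$ and $\lambda/d\le \delta_1$, the graph $G$ contains an induced cycle of length at least $\delta_2 n/d$.
   Context: Graphs are finite and simple. Given a $d$-regular graph $G$ on $n$ vertices, let $d=\lambda_1\ge \lambda_2\ge\cdots\ge\lambda_n$ be the eigenvalues of its adjacency matrix (with multiplicity) and let $\lambda=\max\{|\lambda_2|,|\lambda_n|\}$; then $G$ is called an $(n,d,\lambda)$-graph. An induced cycle of $G$ is an induced subgraph of $G$ that is a cycle. *)

(* Defs.v *)
From HB Require Import structures.
From mathcomp Require Import all_boot all_order all_algebra.
From mathcomp Require Import reals.
Set Implicit Arguments.
Unset Strict Implicit.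
Unset Printing Implicit Defensive.
Import Order.TTheory GRing.Theory Num.Theory.
Local Open Scope ring_scope.

Record sgraph := SGraph {
  vertex :> finType;
  adj : rel vertex;
  adj_sym : symmetric adj;
  adj_irr : irreflexive adj }.

Definition regular (G : sgraph) (d : nat) : Prop :=
  forall x : G, #|[set y | adj x y]| = d.

Definition adjmx (R : realType) (G : sgraph) : 'M[R]_#|G| :=
  \matrix_(i, j) (adj (enum_val i) (enum_val j))%:R.

(* Eigenvalues are the roots of the characteristic polynomial, repeated
   according to multiplicity. At most one s satisfies this for a given A, and
   one does whenever A is symmetric. *)
Definition is_spectrum (R : realType) (n : nat) (A : 'M[R]_n) (s : seq R) :
    Prop :=
  sorted >=%R s /\ char_poly A = \prod_(a <- s) ('X - a%:P).

(* The i-th largest eigenvalue is s`_(i.-1). That the largest one, s`_0, equals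
   d is a consequence of regularity and is not assumed. The default value of nth
   is never used when 0 < d, since then n is at least 2. *)
Definition ndlambda_graph (R : realType) (n d : nat) (lambda : R)
    (G : sgraph) : Prop :=
  [/\ #|G| = n, regular G d &
      exists2 s : seq R, is_spectrum (adjmx R G) s &
        lambda = Num.max `|s`_1| `|s`_n.-1| ].

Section Induced.
Variables (G : sgraph) (S : {set G}).

Definition induced_adj : rel {x : G | x \in S} :=
  fun x y => adj (val x) (val y).

Lemma induced_adj_sym : symmetric induced_adj.
Proof. by move=> x y; apply: adj_sym. Qed.

Lemma induced_adj_irr : irreflexive induced_adj.
Proof. by move=> x; apply: adj_irr. Qed.

Definition induced : sgraph := SGraph induced_adj_sym induced_adj_irr.
End Induced.

(* ordS is the successor modulo k. *)
Definition is_cycle (G : sgraph) (k : nat) : Prop :=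
  (3 <= k)%N /\
  exists f : 'I_k -> G, bijective f /\
    forall i j : 'I_k, adj (f i) (f j) = (j == ordS i) || (i == ordS j).

Definition has_induced_cycle (G : sgraph) (k : nat) : Prop :=
  exists S : {set G}, is_cycle (induced S) k.

(* Main.v *)
Require Import Defs.
From mathcomp Require Import all_boot all_order all_algebra.
From mathcomp Require Import spectral sesquilinear.
From mathcomp Require Import boolp reals complex.
From mathcomp Require Import zify ring lra.
Set Implicit Arguments.
Unset Strict Implicit.
Unset Printing Implicit Defensive.
Import Order.TTheory GRing.Theory Num.Theory.
Local Open Scope ring_scope.

(** Why the theorem holds. Write N(X) for the set of vertices with a neighbour
in X, and let lambda <= d / 128.

Spectral input. The all-ones vector spans the eigenspace of d, and on its
orthogonal complement the adjacency matrix multiplies norms by at most lambda,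
which gives the expander mixing lemma [expander_mixing]. Besides regularity,
three consequences are all that the combinatorial part uses: few vertices have
more than d/4 neighbours in a set Q with |Q| <= n/8 ([mixing_sparse_overlap]),
two sets with no edge between them cannot both be large
([mixing_well_joined]), and d is not tiny ([mixing_degree_large]).

A long induced path. Explore the graph by depth-first search. A vertex v
reserves, when it is visited, the set q v of its neighbours outside N(T), where
T is the set of vertices visited earlier; the search moves on from v only to a
vertex of q v, so the current stack is always an induced path. It moves only to
vertices having at most d/4 neighbours in N(T), so that every reserved set has
at least 3d/4 elements. When it retreats from v for good, q v consists of
visited vertices and of vertices with more than d/4 neighbours in N(T). As the
reserved sets are disjoint and there are few vertices of the second kind, the
abandoned vertices never outnumber the stack ([few_dead]). Hence the search
cannot die out while the visited set has at most order n/d vertices, and the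
stack reaches a length of that order ([long_fresh_path]).

Closing the path. Cut an induced path of 3m vertices, m of order n/d, into
thirds s1, s2, s3, and let Z be the set of vertices off the path and not
adjacent to s2. Thanks to the reserved sets, both N(s1) and N(s3) meet Z in
order dm = order n vertices, so some path w inside Z leads from N(s1) to N(s3)
([well_joined_path]). Together with the segment of the path between its two
attachment points, w forms a cycle through s2; a cheapest such choice has no
chord, since a chord would give a cheaper one ([min_detour_cycle]). *)

(** * Spectral gap and the expander mixing lemma *)

Section Gap.
Local Open Scope sesquilinear_scope.
Variable C : numClosedFieldType.

Definition sqnorm n (v : 'rV[C]_n) : C := (v *m v^t*) 0 0.

Lemma sqnormE n (v : 'rV[C]_n) : sqnorm v = \sum_i `|v 0 i| ^+ 2.
Proof. by rewrite /sqnorm mxE; apply: eq_bigr => i _; rewrite !mxE -normCK. Qed.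

Lemma sqnorm_unitary n (P : 'M[C]_n) (v : 'rV_n) :
  P \is unitarymx -> sqnorm (v *m P) = sqnorm v.
Proof.
move=> /unitarymxP PP; rewrite /sqnorm trmx_mul map_mxM /=.
by rewrite mulmxA -[v *m P *m _]mulmxA PP mulmx1.
Qed.

(** In an orthonormal eigenbasis, u is supported on the single coordinate i0 of
eigenvalue d, since all the other eigenvalues are smaller in modulus. Thus a
vector orthogonal to u has no i0-coordinate, and A multiplies each of its other
coordinates by a factor of modulus at most lambda. *)
Lemma spectral_gap n (A : 'M[C]_n) (u v : 'rV[C]_n) (d lambda : C) (s : seq C) :
    A \is normalmx -> char_poly A = \prod_(a <- d :: s) ('X - a%:P) ->
    (forall a, a \in s -> `|a| <= lambda) -> lambda < `|d| ->
    u != 0 -> u *m A = d *: u -> v *m u^t* = 0 ->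
  sqnorm (v *m A) <= lambda ^+ 2 * sqnorm v.
Proof.
move=> An chA sle ltd u0 uA vu.
have Pu := spectral_unitarymx A.
have /orthomx_spectralP AE := An.
move: Pu AE; set P := spectralmx A; set D := spectral_diag A => Pu AE.
rewrite invmx_unitary // in AE.
have PPs : P *m P^t* = 1%:M by apply/unitarymxP.
have PsP : P^t* *m P = 1%:M by rewrite -invmx_unitary // mulVmx // unitarymx_unit.
have chD : \prod_i ('X - (D 0 i)%:P) = ('X - d%:P) * \prod_(a <- s) ('X - a%:P).
  move: chA; rewrite big_cons => <-.
  have -> : char_poly A = char_poly (diag_mx D).
    rewrite /char_poly; have -> : char_poly_mx A
      = map_mx polyC (P^t*) *m char_poly_mx (diag_mx D) *m map_mx polyC P.
      rewrite /char_poly_mx mulmxBr mulmxBl -!map_mxM /= -AE.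
      by rewrite scalar_mxC -mulmxA -map_mxM /= PsP map_mx1 mulmx1.
    rewrite !det_mulmx mulrAC -det_mulmx -map_mxM /= PsP map_mx1 det1.
    by rewrite mul1r.
  rewrite char_poly_trig ?diag_mx_is_trig //; apply: eq_bigr => i _.
  by rewrite mxE eqxx mulr1n.
(* Cancelling 'X - d leaves s as the multiset of the diagonal entries other than
   the one at i0. *)
have [i0 Di0] : exists i, D 0 i = d.
  have : root (\prod_i ('X - (D 0 i)%:P)) d by rewrite chD rootM root_XsubC eqxx.
  rewrite rootE horner_prod => /prodf_eq0[i _].
  by rewrite hornerXsubC subr_eq0 => /eqP ->; exists i.
have Dle i : i != i0 -> `|D 0 i| <= lambda.
  move=> ii0; apply: sle; move: chD; rewrite (bigD1 i0) //= Di0.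
  move=> /(mulfI (negbT (polyXsubC_eq0 _))) E.
  by rewrite -root_prod_XsubC -E (bigD1 i) //= rootM root_XsubC eqxx.
have [y yE] : exists y, y = u *m P^t* by exists (u *m P^t*).
have [z zE] : exists z, z = v *m P^t* by exists (v *m P^t*).
have yD i : y 0 i * D 0 i = d * y 0 i.
  have: y *m diag_mx D = d *: y.
    by rewrite yE scalemxAl -uA [in RHS]AE !mulmxA -[_ *m P *m _]mulmxA PPs mulmx1.
  by move=> /matrixP/(_ 0 i); rewrite mul_mx_diag !mxE.
have y0 i : i != i0 -> y 0 i = 0.
  move=> ii0; apply/eqP; have := yD i; rewrite mulrC => /eqP.
  rewrite -subr_eq0 -mulrBl mulf_eq0 => /orP[|//].
  rewrite subr_eq0 => /eqP E; have := Dle i ii0.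
  by rewrite E => /(lt_le_trans ltd); rewrite ltxx.
have zy : z *m y^t* = 0.
  rewrite zE yE trmx_mul map_mxM /= trmxCK mulmxA -[_ *m P]mulmxA PsP mulmx1. exact: vu.
have yi0 : y 0 i0 != 0.
  apply: contraNneq u0 => yi0.
  have y00 : y = 0.
    by apply/rowP => i; rewrite [RHS]mxE; case: (eqVneq i i0) => [->|/y0].
  by rewrite -[u]mulmx1 -PsP mulmxA -yE y00 mul0mx.
have z0 : z 0 i0 = 0.
  move/matrixP: zy => /(_ 0 0); rewrite !mxE (bigD1 i0) //= big1 => [|i ii0]; last first.
    by rewrite !mxE y0 // conjC0 mulr0.
  rewrite addr0 !mxE => /eqP; rewrite mulf_eq0 conjC_eq0 (negbTE yi0) orbF.
  by move=> /eqP.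
have -> : sqnorm (v *m A) = sqnorm (z *m diag_mx D).
  by rewrite AE !mulmxA sqnorm_unitary // -zE.
have -> : sqnorm v = sqnorm z.
  by rewrite zE sqnorm_unitary // trmxC_unitary.
rewrite !sqnormE mulr_sumr; apply: ler_sum => i _.
rewrite mul_mx_diag !mxE normrM exprMn mulrC.
have [->|ii0] := eqVneq i i0; first by rewrite z0 normr0 expr0n /= !mulr0.
rewrite ler_wpM2r ?exprn_ge0 // lerXn2r // ?nnegrE // ?Dle //.
by apply: le_trans (Dle i ii0).
Qed.
End Gap.
Definition nbr (G : sgraph) (x : G) : {set G} := [set y | adj x y].

Section Mixing.
Variable R : realType.

(** The unitary diagonalisation lives over an algebraically closed field, so a
real symmetric matrix is embedded into the complex ones. *)
Lemma real_spectral_gap n (A : 'M[R]_n) (u v : 'rV[R]_n) (d lambda : R) (s : seq R) :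
    A^T = A -> char_poly A = \prod_(a <- d :: s) ('X - a%:P) ->
    (forall a, a \in s -> `|a| <= lambda) -> lambda < `|d| ->
    u != 0 -> u *m A = d *: u -> \sum_i v 0 i * u 0 i = 0 ->
  \sum_i (v *m A) 0 i ^+ 2 <= lambda ^+ 2 * \sum_i v 0 i ^+ 2.
Proof.
move=> As chA sle ltd u0 uA vu.
pose f : {rmorphism R -> R[i]%C} := real_complex R.
have lef x y : (f x <= f y) = (x <= y) by apply: lecR.
have normf x : `|f x| = f `|x| by rewrite normc_def /= expr0n addr0 sqrtr_sqr.
have conjf m p (M : 'M[R]_(m, p)) : map_mx Num.conj (map_mx f M) = map_mx f M.
  by apply/matrixP => i j; rewrite !mxE conj_Creal // complex_real.
have sqnormf m (w : 'rV[R]_m) : sqnorm (map_mx f w) = f (\sum_i w 0 i ^+ 2).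
  rewrite sqnormE rmorph_sum; apply: eq_bigr => i _.
  by rewrite mxE normf -rmorphXn /= real_normK // num_real.
have := @spectral_gap (R[i])%C n (map_mx f A) (map_mx f u) (map_mx f v) (f d)
  (f lambda) (map f s).
rewrite sqnormf -rmorphXn -rmorphM => gap; rewrite -lef -sqnormf map_mxM; apply: gap.
- by apply/normalmxP; rewrite map_trmx conjf As.
- rewrite -map_char_poly chA rmorph_prod -map_cons big_map.
  by apply: eq_bigr => a _; rewrite /= map_polyXsubC.
- by move=> _ /mapP[a /sle ale ->]; rewrite normf lef.
- by rewrite normf; have := ltcR lambda `|d|; rewrite ltd.
- by rewrite map_mx_eq0.
- by rewrite -map_mxM uA map_mxZ.
- rewrite map_trmx conjf -map_mxM; apply/matrixP => i j; rewrite !ord1 !mxE.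
  under eq_bigr do rewrite mxE.
  by rewrite vu rmorph0.
Qed.

Lemma cauchy_schwarz (I : finType) (a b : I -> R) :
  (\sum_i a i * b i) ^+ 2 <= (\sum_i a i ^+ 2) * (\sum_i b i ^+ 2).
Proof.
have expand (q p : R) : \sum_i (q * a i - p * b i) ^+ 2 =
    q ^+ 2 * (\sum_i a i ^+ 2) - 2 * q * p * (\sum_i a i * b i)
    + p ^+ 2 * (\sum_i b i ^+ 2).
  rewrite !mulr_sumr -sumrB -big_split /=.
  by apply: eq_bigr => i _; ring.
set P := \sum_i a i * b i; set Q := \sum_i b i ^+ 2.
have Q0 : 0 <= Q by apply: sumr_ge0 => i _; rewrite sqr_ge0.
have [Qz|Qn] := eqVneq Q 0.
  have bz i : b i = 0.
    apply/eqP; rewrite -sqrf_eq0; apply/eqP.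
    by apply: (psumr_eq0P _ Qz) => // j _; rewrite sqr_ge0.
  by rewrite /P big1 ?expr0n ?mulr_ge0 ?sumr_ge0 // => i _; rewrite ?sqr_ge0 // bz mulr0.
have : 0 <= \sum_i (Q * a i - P * b i) ^+ 2 by apply: sumr_ge0 => i _; rewrite sqr_ge0.
have -> : \sum_i (Q * a i - P * b i) ^+ 2
   = Q * (Q * (\sum_i a i ^+ 2) - P ^+ 2).
  by rewrite expand -/P -/Q; ring.
by rewrite pmulr_rge0 ?lt_def ?Qn // subr_ge0 mulrC.
Qed.

Lemma edge_count_sym (G : sgraph) (S T : {set G}) :
  (\sum_(x in S) #|nbr x :&: T| = \sum_(y in T) #|nbr y :&: S|)%N.
Proof.
have E (X Y : {set G}) :
    (\sum_(x in X) #|nbr x :&: Y| = \sum_(x in X) \sum_(y in Y) adj x y)%N.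
  apply: eq_bigr => x _; rewrite -sum1_card big_mkcond [in RHS]big_mkcond.
  by apply: eq_bigr => y _; rewrite !inE; case: adj; case: (y \in Y).
rewrite !E exchange_big; apply: eq_bigr => y _; apply: eq_bigr => x _.
by rewrite adj_sym.
Qed.

(** This is why lambda bounds every eigenvalue but the largest: each of them
lies between the last one and the second one. *)
Lemma sorted_ge_tail_bound (s : seq R) :
  sorted >=%R s -> forall a, a \in behead s ->
  `|a| <= Num.max `|s`_1| `|s`_(size s).-1|.
Proof.
move=> ss a; case: s ss => // b s /= ss /(nthP 0)[i ilt <-].
have ge2 : transitive (>=%R : rel R) by move=> x y z yx zy; apply: le_trans zy yx.
have mono j k : (j <= k)%N -> (k < size s)%N -> s`_k <= s`_j.
  move=> jk ks; have := @sorted_leq_nth _ _ ge2 lexx 0 _ (path_sorted ss) j k.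
  by rewrite !inE ks (leq_ltn_trans jk ks); apply.
have last_s : (b :: s)`_(size s) = s`_(size s).-1 by case: (size s) ilt.
rewrite last_s ler_norml le_max; have [a0|a0] := leP 0 s`_i; last first.
  have lei : s`_(size s).-1 <= s`_i by apply: mono; case: (size s) ilt.
  apply/andP; split; last by rewrite (le_trans (ltW a0)).
  rewrite lerNl le_max; apply/orP; right.
  by rewrite ler0_norm ?lerN2 // (le_trans lei) // ltW.
have lei : s`_i <= s`_0 by apply: mono.
apply/andP; split; first by rewrite (le_trans _ a0) // oppr_le0 le_max normr_ge0.
by rewrite (le_trans lei) ?ler_norm.
Qed.

(** Project the indicator vector of S orthogonally to the all-ones vector u. The
component along u contributes the main term d|S||T|/n to the number of edges
between S and T, and the orthogonal component v contributes at most
lambda |v| |T|^(1/2) by the spectral gap and Cauchy-Schwarz. *)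
Lemma expander_mixing n d lambda (G : sgraph) (S T : {set G}) :
    (0 < n)%N -> ndlambda_graph n d lambda G -> lambda < d%:R ->
  ((\sum_(x in S) #|nbr x :&: T|)%:R - d%:R * #|S|%:R * #|T|%:R / n%:R) ^+ 2
    <= lambda ^+ 2 * #|S|%:R * #|T|%:R :> R.
Proof.
move=> n_gt0 [Gn reg [s [ss chs] lE]] ltd.
set A := adjmx R G in chs.
have As : A^T = A by apply/matrixP => i j; rewrite !mxE adj_sym.
pose chi (X : {set G}) : 'rV[R]_#|G| := \row_i (enum_val i \in X)%:R.
pose u : 'rV[R]_#|G| := const_mx 1.
have sum_chi (X : {set G}) : \sum_i chi X 0 i = #|X|%:R.
  under eq_bigr do rewrite mxE.
  rewrite -natr_sum -(big_enum_val (A := G) (fun x : G => nat_of_bool (x \in X))) /=.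
  by rewrite -sum1_card [in RHS]big_mkcond; congr (_%:R); apply: eq_bigr => x _; case: ifP.
have chiA (X : {set G}) i : (chi X *m A) 0 i = #|nbr (enum_val i) :&: X|%:R.
  rewrite mxE -sum_chi; apply: eq_bigr => j _; rewrite !mxE !inE adj_sym.
  by rewrite -natrM mulnb andbC.
have uA : u *m A = d%:R *: u.
  apply/rowP => i; have -> : u = chi setT by apply/rowP => j; rewrite !mxE inE.
  by rewrite chiA setIT reg !mxE inE mulr1.
have u0 : u != 0.
  apply: contraTneq n_gt0 => /rowP uz; rewrite -Gn lt0n negbK -leqn0 leqNgt.
  by apply/negP => G0; have /eqP := uz (Ordinal G0); rewrite !mxE oner_eq0.
have sn : size s = n.
  by have := size_char_poly A; rewrite chs size_prod_XsubC Gn => -[].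
(* d is an eigenvalue and exceeds lambda, hence comes first in the spectrum,
   exactly once. *)
have [s' sE sle] : exists2 s', s = d%:R :: s' & forall a, a \in s' -> `|a| <= lambda.
  have : d%:R \in s.
    rewrite -root_prod_XsubC -chs -eigenvalue_root_char.
    by apply/eigenvalueP; exists u.
  have := sorted_ge_tail_bound ss; rewrite sn -lE.
  case: (s) => // a s' /= sle; rewrite inE => /predU1P[<-|/sle]; first by exists s'.
  by rewrite normr_nat leNgt ltd.
have [c cE] : exists c : R, c = #|S|%:R / n%:R by exists (#|S|%:R / n%:R).
have n0 : n%:R != 0 :> R by rewrite pnatr_eq0 -lt0n.
have [v vE] : exists v, v = chi S - c *: u by eexists.
have vi i : v 0 i = chi S 0 i - c by rewrite vE !mxE mulr1.
have vu : \sum_i v 0 i * u 0 i = 0.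
  under eq_bigr do rewrite vi [u _ _]mxE mulr1.
  by rewrite sumrB sum_chi sumr_const card_ord Gn -(mulr_natr c) cE divfK ?subrr.
rewrite sE in chs; have := real_spectral_gap As chs sle _ u0 uA vu.
rewrite normr_nat => /(_ ltd) gap.
have v2 : \sum_i v 0 i ^+ 2 <= #|S|%:R.
  have -> : \sum_i v 0 i ^+ 2 = #|S|%:R - c * #|S|%:R.
    transitivity (\sum_i (chi S 0 i - 2 * c * chi S 0 i + c ^+ 2)).
      apply: eq_bigr => i _; rewrite vi !mxE; case: (_ \in _) => /=; ring.
    rewrite big_split sumrB /= -mulr_sumr sum_chi sumr_const card_ord Gn -(mulr_natr (c ^+ 2)).
    by rewrite [c]cE; field.
  by rewrite gerBl cE mulr_ge0 ?divr_ge0.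
have := cauchy_schwarz (fun i => (v *m A) 0 i) (fun i => chi T 0 i).
have -> : \sum_i (v *m A) 0 i * chi T 0 i =
    (\sum_(x in S) #|nbr x :&: T|)%:R - d%:R * #|S|%:R * #|T|%:R / n%:R.
  rewrite vE mulmxBl -scalemxAl uA.
  transitivity (\sum_i ((chi S *m A) 0 i * chi T 0 i - c * d%:R * chi T 0 i)).
    by apply: eq_bigr => i _; rewrite !mxE; ring.
  rewrite sumrB -mulr_sumr sum_chi cE; congr (_ - _); last by field.
  have -> : \sum_i (chi S *m A) 0 i * chi T 0 i =
      \sum_(i < #|G|) (#|nbr (enum_val i) :&: S| * (enum_val i \in T))%:R.
    apply: eq_bigr => i _; rewrite natrM; congr (_ * _); last by rewrite mxE.
    exact: chiA.
  rewrite -natr_sum edge_count_sym; congr (_%:R).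
  rewrite -(big_enum_val (A := G) (fun y => #|nbr y :&: S| * (y \in T))%N) /=.
  rewrite [RHS]big_mkcond; apply: eq_bigr => y _.
  by case: ifP; rewrite ?muln1 ?muln0.
have -> : \sum_i chi T 0 i ^+ 2 = #|T|%:R.
  by rewrite -sum_chi; apply: eq_bigr => i _; rewrite !mxE; case: (_ \in _) => /=; ring.
move=> /le_trans; apply; rewrite ler_wpM2r // (le_trans gap) //.
by rewrite ler_wpM2l // sqr_ge0.
Qed.
End Mixing.

(** * Combinatorial consequences of expansion *)

Section Graph.
Local Open Scope nat_scope.
Variable G : sgraph.
Implicit Types (x u v w : G) (s : seq G) (X Y Q B D : {set G}) (q : G -> {set G}).

Definition nbrs X : {set G} := \bigcup_(x in X) nbr x.

Lemma mem_nbrs x y X : x \in X -> adj x y -> y \in nbrs X.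
Proof. by move=> xX xy; apply/bigcupP; exists x; rewrite ?inE. Qed.

Lemma nbrsS X Y : X \subset Y -> nbrs X \subset nbrs Y.
Proof.
by move=> XY; apply/bigcupsP => x xX; apply: bigcup_sup; apply: (subsetP XY).
Qed.

Lemma leq_card_bigcup X q : #|\bigcup_(x in X) q x| <= \sum_(x in X) #|q x|.
Proof.
elim/big_rec2: _ => [|x m U _ Um]; first by rewrite cards0.
by apply: leq_trans (leq_card_setU _ _) _; rewrite leq_add2l.
Qed.

Lemma card_nbrs d X : regular G d -> #|nbrs X| <= d * #|X|.
Proof.
move=> reg; rewrite mulnC -sum_nat_const.
apply: leq_trans (leq_card_bigcup _ _) _; apply: leq_sum => x _; by rewrite reg.
Qed.

Lemma leq_card_disjoint_bigcup a q X :
    {in X &, forall v w, v != w -> [disjoint q v & q w]} ->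
    {in X, forall v, a <= 4 * #|q v|} ->
  a * #|X| <= 4 * #|\bigcup_(v in X) q v|.
Proof.
move=> dis qa.
suff: \sum_(v in X) #|q v| <= #|\bigcup_(v in X) q v|.
  move=> le; rewrite mulnC -sum_nat_const.
  apply: (@leq_trans (\sum_(v in X) 4 * #|q v|)); first exact: leq_sum.
  by rewrite -big_distrr /= leq_mul.
rewrite big_mkcond /=.
pose F v := if v \in X then q v else set0.
have disF v w : v != w -> [disjoint F v & F w].
  rewrite /F => vw; case: ifP => vX; last by rewrite -setI_eq0 set0I.
  by case: ifP => wX; [apply: dis | rewrite -setI_eq0 setI0].
have -> : \bigcup_(v in X) q v = \bigcup_v F v.
  by rewrite [LHS]big_mkcond.
rewrite -[X in _ <= X]sum1_card partition_disjoint_bigcup //; apply: leq_sum => v _.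
by rewrite sum1_card /F; case: ifP; rewrite ?cards0.
Qed.

Definition crowded d Q : {set G} := [set u | d < 4 * #|nbr u :&: Q|].

Definition sparse_overlap d := forall B Q,
  8 * #|Q| <= #|G| -> B \subset crowded d Q -> 256 * #|B| <= #|Q|.

(** The mixing lemma would allow the constant 128^2; the connectivity argument
needs one larger than 1024. *)
Definition well_joined := forall X Y,
  {in X & Y, forall x y, ~~ adj x y} -> 2048 * (#|X| * #|Y|) <= #|G| ^ 2.

(** * Depth-first search for a long induced path *)

(** The stack s is listed with its newest vertex first, and q v is the set
reserved by v when it was pushed, from which the next vertex was taken.
Disjointness of q v from the neighbourhoods of all older vertices is what makes
the path induced. *)
Fixpoint fresh_path q s :=
  if s is v :: s' then
    [&& v \notin s', q v \subset nbr v :\: nbrs [set x in s'],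
        (if s' is w :: _ then v \in q w else true) & fresh_path q s']
  else true.

Lemma eq_fresh_path q q' s :
  {in s, q =1 q'} -> fresh_path q s = fresh_path q' s.
Proof.
elim: s => //= v s IH qq'; rewrite IH => [|x xs]; last by apply: qq'; rewrite inE xs orbT.
rewrite qq' ?mem_head //; case: s {IH} qq' => // w s ->//.
by rewrite !inE eqxx orbT.
Qed.

Lemma fresh_path_uniq q s : fresh_path q s -> uniq s.
Proof. by elim: s => //= v s IH /and4P[-> _ _ /IH]. Qed.

Local Notation visited s D := ([set x in s] :|: D).
Local Notation exhausted d T := (T :|: crowded d (nbrs T)).

(** A state of the search: s is the stack and D the set of the vertices from
which the search has retreated. *)
Record exploration d s D q := Exploration {
  exp_path : fresh_path q s;
  exp_disj : [disjoint [set x in s] & D];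
  exp_nbr : {in visited s D, forall v, q v \subset nbr v};
  exp_large : {in visited s D, forall v, 3 * d <= 4 * #|q v|};
  exp_sep : {in visited s D &, forall v w, v != w -> [disjoint q v & q w]};
  exp_dead : {in D, forall v, q v \subset exhausted d (visited s D)} }.

Lemma exploration_card d s D q :
  exploration d s D q -> #|visited s D| = size s + #|D|.
Proof.
case=> /fresh_path_uniq /card_uniqP us /disjoint_setI0 dis _ _ _ _.
by rewrite cardsU dis cards0 subn0 cardsE us.
Qed.

(** The reserved sets of the vertices of D are disjoint, have at least 3d/4
elements each, and lie in the visited set T together with the crowded vertices,
of which there are at most |N(T)|/256 <= d|T|/256. This leaves room for |D|
only up to a fraction of |T| = |s| + |D|. *)
Lemma few_dead d s D q : regular G d -> 12 <= d -> sparse_overlap d ->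
    exploration d s D q -> 8 * (d * (size s + #|D|)) <= #|G| -> 
  #|D| <= size s.
Proof.
move=> reg d12 sparse E small; have cT := exploration_card E.
set T := _ :|: D in cT; have [_ _ _ large sep dead] := E.
have DT : {subset D <= T} by move=> x xD; rewrite inE xD orbT.
have cN : #|nbrs T| <= d * (size s + #|D|) by rewrite -cT card_nbrs.
have cB : 256 * #|crowded d (nbrs T)| <= #|nbrs T|.
  by apply: sparse => //; apply: leq_trans small; rewrite leq_mul2l.
have qD : 3 * d * #|D| <= 4 * #|\bigcup_(v in D) q v|.
  apply: leq_card_disjoint_bigcup => [v w vD wD|v vD].
    by apply: sep; apply: DT.
  by apply: large; apply: DT.
have : #|\bigcup_(v in D) q v| <= #|T| + #|crowded d (nbrs T)|.
  apply: leq_trans (leq_card_setU _ _); apply: subset_leq_card.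
  by apply/bigcupsP => v /dead.
rewrite cT leqNgt => qT; apply/negP => sD.
have : d * (size s + #|D|) <= d * (2 * #|D|) by rewrite leq_mul2l; apply/orP; right; lia.
have : 12 * #|D| <= d * #|D| by rewrite leq_mul2r d12 orbT.
by nia.
Qed.

Lemma crowdedS d Q Q' : Q \subset Q' -> crowded d Q \subset crowded d Q'.
Proof.
move=> QQ'; apply/subsetP => u; rewrite !inE => /leq_trans; apply.
by rewrite leq_mul2l /=; apply: subset_leq_card; apply: setIS.
Qed.

Lemma exploration_retreat d v s D q : exploration d (v :: s) D q ->
    q v \subset exhausted d (visited (v :: s) D) ->
  exploration d s (v |: D) q.
Proof.
case=> path dis qn ql qs dead qv.
have TE : [set x in s] :|: (v |: D) = [set x in v :: s] :|: D.
  by apply/setP => x; rewrite !inE; case: (x == v); rewrite /= ?orbT.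
split; rewrite ?TE //.
- by case/and4P: path.
- rewrite disjoints_subset; apply/subsetP => x; rewrite !inE negb_or => xs.
  rewrite (disjointFr dis) ?inE ?xs ?orbT // andbT.
  by apply: contraTneq xs => ->; case/and4P: path.
- by move=> x /setU1P[->|/dead].
Qed.

(** The new vertex reserves its neighbours outside N(T), where T is the visited
set, so its set is disjoint from all earlier ones, and since the vertex is not
crowded this set has at least 3d/4 elements. Enlarging T preserves the condition
on the vertices of D, which is monotone in T. *)
Lemma exploration_advance d u v s D q : regular G d ->
    exploration d (v :: s) D q -> u \in q v ->
    u \notin exhausted d (visited (v :: s) D) ->
  exists q', exploration d (u :: v :: s) D q'.
Proof.
move=> reg [path dis qn ql qs dead] uqv.
set T := _ :|: D in qn ql qs dead *; rewrite inE negb_or => /andP[uT uC].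
pose q' x := if x == u then nbr u :\: nbrs T else q x; exists q'.
have q'E : {in T, q' =1 q}.
  by move=> x xT; rewrite /q'; case: eqP uT => // <-; rewrite xT.
have q'u : q' u = nbr u :\: nbrs T by rewrite /q' eqxx.
have sT : [set x in v :: s] \subset T by apply: subsetUl.
have TE : [set x in u :: v :: s] :|: D = u |: T.
  by apply/setP => x; rewrite !inE; case: (x == u).
have TT' : T \subset u |: T by apply: subsetUr.
have sep x : x \in T -> [disjoint q' u & q' x].
  move=> xT; rewrite (q'E x) // q'u disjoint_sym disjoints_subset.
  apply: subset_trans (qn x xT) _; apply/subsetP => y; rewrite !inE => xy.
  by rewrite (mem_nbrs xT xy).
split; rewrite ?TE.
- rewrite /= -/(fresh_path q' (v :: s)).
  have -> : fresh_path q' (v :: s) = fresh_path q (v :: s).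
    by apply: eq_fresh_path => x xs; apply: q'E; rewrite !inE -in_cons xs.
  rewrite path (q'E v) ?uqv ?andbT; last by rewrite !inE eqxx.
  rewrite q'u setDS ?nbrsS //= andbT.
  by apply: contra uT => us; rewrite inE inE us.
- rewrite disjoints_subset; apply/subsetP => x; rewrite inE in_cons in_setC.
  case/predU1P => [->|xs]; first by apply: contra uT => uD; rewrite inE uD orbT.
  by rewrite (disjointFr dis) // inE.
- move=> x /setU1P[->|xT]; last by rewrite (q'E x) ?qn.
  by rewrite q'u subsetDl.
- move=> x /setU1P[->|xT]; last by rewrite (q'E x) ?ql.
  rewrite q'u cardsD reg; move: uC; rewrite inE -leqNgt; lia.
- move=> x y /setU1P[->|xT] /setU1P[->|yT]; rewrite ?eqxx //.
  + by move=> _; apply: sep.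
  + by move=> _; rewrite disjoint_sym; apply: sep.
  + by rewrite !q'E //; apply: qs.
- move=> x xD; rewrite q'E; last by rewrite inE xD orbT.
  apply: subset_trans (dead x xD) _; apply: setUSS => //.
  by apply: crowdedS; apply: nbrsS.
Qed.

(** Each step of the search, forward or backward, increases |s| + 2|D| by one,
and this quantity is bounded by 3n. The search cannot stop with an empty stack
because |D| <= |s|; hence it stops only when the stack has the wanted size. *)
Lemma long_fresh_path d k : regular G d -> 12 <= d -> sparse_overlap d ->
    0 < k -> 16 * (d * k) <= #|G| ->
  exists q s, [/\ fresh_path q s, size s = k &
    {in s, forall v, 3 * d <= 4 * #|q v|}].
Proof.
move=> reg d12 sparse k0 small.
have step N : exists s D q, [/\ exploration d s D q, size s <= k, #|D| <= size s &
    (size s == k) || (N < size s + #|D|.*2)].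
  elim: N => [|N [s [D [q [E sk Ds]]]]].
    have [x0 _] : exists x0 : G, x0 \in G.
      by apply/card_gt0P; apply: leq_trans small; rewrite !muln_gt0 k0 (leq_trans _ d12).
    exists [:: x0], set0, (@nbr G).
    have TE : [set x in [:: x0]] :|: set0 = [set x0].
      by apply/setP => x; rewrite !inE orbF.
    split => //; rewrite ?cards0 //; last by rewrite orbT.
    split; rewrite ?TE //=.
    - rewrite andbT; apply/subsetP => y; rewrite in_setD => ->; rewrite andbT.
      by apply/bigcupP => -[z]; rewrite inE.
    - by rewrite -setI_eq0 setI0.
    - by move=> v /set1P ->; rewrite reg leq_mul2r orbT.
    - by move=> v w /set1P -> /set1P ->; rewrite eqxx.
    - by move=> v; rewrite inE.
  have [sE _|sE /= NE] := boolP (size s == k).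
    by exists s, D, q; split; rewrite ?sE.
  have {sE} sk' : size s < k by rewrite ltn_neqAle sE.
  case: s => [|v s] in E NE sk Ds sk' *.
    by move: Ds NE; rewrite leqn0 => /eqP ->.
  have [dead|/subsetPn[u uq uT]] := boolP (q v \subset exhausted d (visited (v :: s) D)).
    exists s, (v |: D), q.
    have E' := exploration_retreat E dead.
    split => //; first exact: ltnW.
      (* Before the retreat D is no larger than the stack, so at most 2k
         vertices are visited. *)
      apply: (few_dead reg d12 sparse E'); apply: leq_trans small.
      rewrite mulnCA [16 * _]mulnCA leq_mul2l; apply/orP; right.
      by rewrite cardsU1; move: Ds sk => /=; lia.
    have vD : v \notin D by rewrite (disjointFr (exp_disj E)) // inE mem_head.
    rewrite cardsU1 vD /=.
    by apply/orP; right; move: NE => /=; lia.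
  have [q' E'] := exploration_advance reg E uq uT.
  exists (u :: v :: s), D, q'; split => //; first exact: leqW.
  by apply/orP; right; move: NE => /=; lia.
have [s [D [q [E sk Ds]]]] := step (3 * #|G|).
case/orP=> [/eqP sE|].
  exists q, s; split=> // [|v vs]; first exact: exp_path E.
  by apply: (exp_large E); rewrite !inE vs.
have sG : size s <= #|G|.
  by rewrite -(card_uniqP (fresh_path_uniq (exp_path E))) max_card.
have DG : #|D| <= #|G| by apply: max_card.
lia.
Qed.

Lemma fresh_path_nbr q s v : fresh_path q s -> v \in s -> q v \subset nbr v.
Proof.
elim: s => //= w s IH /and4P[_ qw _ path]; rewrite inE => /predU1P[->|vs]; last exact: IH.
by apply: subset_trans qw _; apply: subsetDl.
Qed.

Lemma fresh_path_avoid q s s' v :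
  fresh_path q (s ++ s') -> v \in s -> [disjoint q v & nbrs [set x in s']].
Proof.
elim: s => //= w s IH /and4P[_ qw _ path]; rewrite inE => /predU1P[->|vs]; last exact: IH.
rewrite disjoints_subset; apply: subset_trans qw _; rewrite subDset.
apply/subsetP => y _; rewrite !inE orbC -implybE; apply/implyP => /(subsetP (nbrsS _)).
by apply; apply/subsetP => x; rewrite !inE mem_cat => ->; rewrite orbT.
Qed.

Lemma fresh_path_sep q s : fresh_path q s ->
  {in s &, forall v w, v != w -> [disjoint q v & q w]}.
Proof.
elim: s => //= u s IH path; have /and4P[_ _ _ path'] := path.
have dis w : w \in s -> [disjoint q u & q w].
  move=> ws; apply: disjointWr (@fresh_path_avoid q [:: u] s u path (mem_head _ _)).
  apply: subset_trans (fresh_path_nbr path' ws) _.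
  by apply: bigcup_sup; rewrite inE.
move=> v w; rewrite !inE => /predU1P[->|vs] /predU1P[->|ws]; rewrite ?eqxx //.
- by move=> _; apply: dis.
- by move=> _; rewrite disjoint_sym; apply: dis.
- exact: IH.
Qed.

Lemma fresh_path_adj q s x0 i j : fresh_path q s -> i < j < size s ->
  adj (nth x0 s i) (nth x0 s j) = (j == i.+1).
Proof.
elim: s i j => [|v s IH] i j; first by rewrite ltn0 andbF.
move=> /= /and4P[_ _]; case: j => [|j]; first by rewrite ltn0.
case: i => [|i] vq path; last by move=> ij; apply: IH.
rewrite ltnS /=; case: s {IH} vq path => [//|w s] vq path jl.
have /= /and4P[_ /subsetP/(_ v vq) ] := path.
rewrite !inE => /andP[vN wv] _ _; case: j jl => [|j] jl /=; first by rewrite adj_sym.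
apply: contraNF vN => adj_vj; apply: (@mem_nbrs (nth x0 s j)); last by rewrite adj_sym.
by rewrite inE mem_nth.
Qed.

(** * Closing an induced path to an induced cycle *)

Lemma has_induced_cycle_seq (c : seq G) x0 : uniq c -> 3 <= size c ->
    (forall i j, i < j < size c -> adj (nth x0 c i) (nth x0 c j) =
      (j == i.+1) || (i == 0) && (j == (size c).-1)) ->
  has_induced_cycle G (size c).
Proof.
move=> uc c3 adjc; exists [set x in c]; split=> //.
have inS (i : 'I_(size c)) : nth x0 c i \in [set x in c] by rewrite inE mem_nth.
exists (fun i : 'I_(size c) => Sub (nth x0 c i) (inS i) : induced [set x in c]); split.
  apply: inj_card_bij => [i j /(congr1 val) /= /eqP|].
    by rewrite nth_uniq // => /eqP /val_inj.
  by rewrite card_sig card_ord cardsE; move/card_uniqP: uc => ->.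
have ordSE (i j : 'I_(size c)) :
    (j == ordS i) = (j == i.+1 :> nat) || (j == 0 :> nat) && (i == (size c).-1 :> nat).
  rewrite -val_eqE /=; have := ltn_ord i; have := ltn_ord j.
  have [->|iN] := eqVneq (i : nat) (size c).-1.
    by rewrite prednK ?modnn; [lia | lia].
  by move=> *; rewrite modn_small; lia.
move=> i j; rewrite /adj /= /induced_adj /= !ordSE.
have := ltn_ord i; have := ltn_ord j.
case: (ltngtP i j) => [ij|ji|/val_inj ->] jc ic.
- by rewrite adjc ?ij //; lia.
- by rewrite adj_sym adjc ?ji //; lia.
- by rewrite adj_irr; lia.
Qed.

(** The two ends of the induced path s get joined through the region Z, which
keeps away from the middle part of s, so that the cycle contains all of it. *)
Section Detours.
Variables (s : seq G) (x0 : G) (Z : {set G}) (lo hi : nat).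
Hypothesis s_uniq : uniq s.
Hypothesis s_adj : forall i j, i < j < size s ->
  adj (nth x0 s i) (nth x0 s j) = (j == i.+1).
Hypothesis Z_off : [disjoint Z & s].
Hypothesis Z_mid : forall t z, lo <= t < hi -> z \in Z -> ~~ adj (nth x0 s t) z.
Hypothesis lohi : lo <= hi.

Record detour a b (w : seq G) : Prop := Detour {
  detour_ends : b < lo /\ hi <= a < size s;
  detour_gt0 : 0 < size w;
  detour_uniq : uniq w;
  detour_sub : {subset w <= Z};
  detour_path : sorted (@adj G) w;
  detour_first : adj (nth x0 s a) (nth x0 w 0);
  detour_last : adj (nth x0 s b) (nth x0 w (size w).-1) }.

Definition detour_cost a b (w : seq G) := size w + (a - b).

Lemma detour_shorten a b (w : seq G) a' b' (w' : seq G) : detour a b w -> subseq w' w ->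
    b' < lo -> hi <= a' < size s -> 0 < size w' -> sorted (@adj G) w' ->
    adj (nth x0 s a') (nth x0 w' 0) -> adj (nth x0 s b') (nth x0 w' (size w').-1) ->
  detour a' b' w'.
Proof.
case=> _ _ uw wZ _ _ _ sub *; split => //; first exact: subseq_uniq uw.
by move=> x /(mem_subseq sub)/wZ.
Qed.

(** A chord of the cycle formed by s_b, ..., s_a and w has an end in w, because
s is induced. If its other end is some s_t, then t lies outside the middle part
and can replace a or b; if both ends are in w, then w can be shortcut. Either
way a cheaper detour appears. *)
Lemma min_detour_cycle a b (w : seq G) : detour a b w ->
    (forall a' b' (w' : seq G), detour a' b' w' -> detour_cost a b w <= detour_cost a' b' w') ->
  has_induced_cycle G ((a - b).+1 + size w).
Proof.
move=> dw; have [[blo hia] w0 uw wZ pw fw lw] := dw.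
have /andP[ha as_] := hia.
have ba : b <= a by lia.
rewrite /detour_cost => min.
have pw_i := sortedP x0 pw.
have near_a t i : hi <= t <= a -> i < size w -> adj (nth x0 s t) (nth x0 w i) ->
    t = a /\ i = 0.
  move=> tha iw ti.
  suff /min : detour t b (drop i w) by rewrite size_drop; lia.
  apply: (detour_shorten dw); rewrite ?drop_subseq ?size_drop ?nth_drop ?addn0 //.
  - lia.
  - by rewrite subn_gt0.
  - exact: drop_sorted.
  - by have -> : i + (size w - i).-1 = (size w).-1 by lia.
have near_b t i : b <= t < lo -> i < size w -> adj (nth x0 s t) (nth x0 w i) ->
    t = b /\ i = (size w).-1.
  move=> tb iw ti.
  suff /min : detour a t (take i.+1 w) by rewrite size_takel //; lia.
  apply: (detour_shorten dw); rewrite ?take_subseq ?size_takel ?nth_take //.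
  - lia.
  - exact: take_sorted.
have w_adj i j : i < j < size w -> adj (nth x0 w i) (nth x0 w j) = (j == i.+1).
  move=> /andP[ij jw]; apply/idP/eqP => [adj_ij|jE]; last first.
    by rewrite jE; apply: pw_i; rewrite -jE.
  have sz : size (take i.+1 w ++ drop j w) = i.+1 + (size w - j).
    by rewrite size_cat size_takel ?size_drop // ltnW // (leq_ltn_trans ij).
  suff /min : detour a b (take i.+1 w ++ drop j w) by rewrite sz; lia.
  apply: (detour_shorten dw); rewrite ?sz //.
  - rewrite -[X in subseq _ X](cat_take_drop i.+1 w); apply: cat_subseq => //.
    by rewrite -(subnK ij) -drop_drop drop_subseq.
  - apply/(sortedP x0) => k; rewrite sz => kl; rewrite !nth_cat !size_takel; try lia.
    case: (ltngtP k i) => ki.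
    + rewrite ltnS (ltnW ki) ltnS ki !nth_take ?pw_i //; lia.
    + rewrite !ltnS leqNgt ki ltnNge (ltnW ki) /= !nth_drop.
      have -> : j + (k.+1 - i.+1) = (j + (k - i.+1)).+1 by lia.
      by apply: pw_i; lia.
    + by rewrite ki ltnSn ltnn nth_take // nth_drop subnn addn0.
  - by rewrite nth_cat size_takel ?nth_take //; lia.
  - rewrite nth_cat size_takel; last lia.
    rewrite ifF; last lia.
    rewrite nth_drop; have -> : j + ((i.+1 + (size w - j)).-1 - i.+1) = (size w).-1 by lia.
    by [].
pose c := [seq nth x0 s t | t <- iota b (a - b).+1] ++ w.
have sz1 : size [seq nth x0 s t | t <- iota b (a - b).+1] = (a - b).+1.
  by rewrite size_map size_iota.
have szc : size c = (a - b).+1 + size w by rewrite size_cat sz1.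
have nth1 i : i < (a - b).+1 -> nth x0 c i = nth x0 s (b + i).
  move=> il; rewrite nth_cat sz1 il (nth_map 0) ?size_iota //.
  by rewrite nth_iota.
have nth2 i : (a - b).+1 <= i -> nth x0 c i = nth x0 w (i - (a - b).+1).
  by move=> il; rewrite nth_cat sz1 ltnNge il.
rewrite -szc; apply: (@has_induced_cycle_seq c x0).
- rewrite cat_uniq uw andbT; apply/andP; split.
    rewrite map_inj_in_uniq ?iota_uniq // => t t'; rewrite !mem_iota => tb t'b /eqP.
    have [ts t's] : t < size s /\ t' < size s by lia.
    by rewrite nth_uniq // => /eqP.
  apply/hasPn => x /wZ xZ; apply/mapP => -[t]; rewrite mem_iota => tb xE.
  have ts : t < size s by lia.
  by have := disjointFr Z_off xZ; rewrite xE mem_nth.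
- by rewrite szc; lia.
- move=> i j; rewrite szc => /andP[ij jl].
  case: (ltnP j (a - b).+1) => j1.
    rewrite !nth1 //; last exact: ltn_trans j1.
    rewrite s_adj; lia.
  case: (ltnP i (a - b).+1) => i1; last first.
    rewrite !nth2 // w_adj; lia.
  rewrite nth1 // nth2 //; apply/idP/idP => [adj_ij|]; last first.
    have [jE|_] := eqVneq j i.+1.
      move=> _; rewrite jE; have -> : b + i = a by lia.
      by have -> : i.+1 - (a - b).+1 = 0 by lia.
    move=> /= /andP[/eqP -> /eqP ->]; rewrite addn0.
    by have -> : ((a - b).+1 + size w).-1 - (a - b).+1 = (size w).-1 by lia.
  have jw : j - (a - b).+1 < size w by lia.
  have [tlo|tlo] := ltnP (b + i) lo.
    have [] := near_b (b + i) _ _ jw adj_ij; lia.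
  have [thi|thi] := ltnP (b + i) hi.
    have tm : lo <= b + i < hi by rewrite tlo.
    by have := Z_mid tm (wZ _ (mem_nth x0 jw)); rewrite adj_ij.
  have [] := near_a (b + i) _ _ jw adj_ij; lia.
Qed.

Lemma detour_cycle a b (w : seq G) : detour a b w ->
  exists2 k, hi - lo + 3 <= k & has_induced_cycle G k.
Proof.
move=> dw; pose P c := `[< exists a b (w : seq G), detour a b w /\ detour_cost a b w = c >].
have exP : exists c, P c.
  by exists (detour_cost a b w); apply/asboolP; exists a, b, w.
case: (ex_minnP exP) => c /asboolP[a1 [b1 [w1 [dw1 <-]]]] min.
exists ((a1 - b1).+1 + size w1).
  have [[? /andP[? _]] ? _ _ _ _ _] := dw1; lia.
apply: min_detour_cycle => // a' b' w' dw'.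
by apply: min; apply/asboolP; exists a', b', w'.
Qed.

End Detours.

(** Let X be the set of vertices reachable from A inside Z. If X missed B, there
would be no edge between X and its complement in Z, which contain A and B
respectively. One of these two sets has at least 3n/8 elements and the other at
least n/384, so the product of their sizes would be at least n^2/1024,
against the hypothesis. *)
Lemma well_joined_path (Z A B : {set G}) : well_joined -> 0 < #|G| ->
    3 * #|G| <= 4 * #|Z| -> A \subset Z -> B \subset Z ->
    #|G| <= 384 * #|A| -> #|G| <= 384 * #|B| ->
  exists x p, [/\ x \in A, last x p \in B, uniq (x :: p), {subset x :: p <= Z} &
    path (@adj G) x p].
Proof.
move=> joined n0 Zbig AZ BZ Abig Bbig.
pose e := [rel x y | [&& adj x y, x \in Z & y \in Z]].
pose X := [set y in Z | [exists x in A, connect e x y]].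
have [/exists_inP[y yB yX]|BX] := boolP [exists y in B, y \in X].
  move: yX; rewrite inE => /andP[_ /exists_inP[x xA /connectP[p pe yE]]].
  case/shortenP: pe yE => p' pe up _ yE.
  exists x, p'; split; rewrite -?yE //.
    have xZ := subsetP AZ _ xA; move=> z; rewrite inE => /predU1P[-> //|].
    elim: p' x {xA up yE xZ} pe => //= u p' IH x /andP[/and3P[_ _ uZ] /IH sub].
    by rewrite inE => /predU1P[->|/sub].
  by apply: sub_path pe => u v /and3P[].
exfalso.
have XZ : X \subset Z by apply/subsetP => x; rewrite inE => /andP[].
have AX : A \subset X.
  apply/subsetP => x xA; rewrite inE (subsetP AZ) //=.
  by apply/exists_inP; exists x.
have BX' : B \subset Z :\: X.
  apply/subsetP => y yB; rewrite inE (subsetP BZ) // andbT.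
  by move: BX; rewrite negb_exists_in => /forall_inP/(_ y yB).
suff : #|G| ^ 2 < 2048 * (#|X| * #|Z :\: X|).
  rewrite ltnNge => /negP; apply; apply: joined => x y xX; rewrite inE => /andP[yX yZ].
  apply: contra yX => xy; move: xX; rewrite !inE yZ => /andP[xZ /exists_inP[z zA zx]].
  apply/exists_inP; exists z => //; apply: connect_trans zx (connect1 _).
  by rewrite /= xy xZ.
have cZ : #|X| + #|Z :\: X| = #|Z| by rewrite -(cardsID X Z) (setIidPr XZ).
have := subset_leq_card AX; have := subset_leq_card BX'.
move: #|X| #|Z :\: X| #|A| #|B| #|Z| #|G| cZ n0 Zbig Abig Bbig => X1 X2 A1 B1 Z1 n.
move=> cZ n0 Zbig Abig Bbig BX2 AX1.
have nn : 0 < n * n by rewrite muln_gt0 n0.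
rewrite -mulnn; have [le|lt] := leqP X1 X2.
  have : n * (3 * n) <= (384 * X1) * (8 * X2) by apply: leq_mul; lia.
  by rewrite mulnACA mulnCA; move: nn; lia.
have : n * (3 * n) <= (384 * X2) * (8 * X1) by apply: leq_mul; lia.
by rewrite mulnACA mulnCA [X2 * X1]mulnC; move: nn; lia.
Qed.

(** With the path cut as s3 ++ s2 ++ s1, newest vertices first, the vertices of
s3 avoid N(s2) with their reserved sets by construction. Those of s1 were
reserved before s2 was visited, but each w in s2 has only d - |q w| <= d/4
neighbours in N(s1), so N(s2) covers at most a third of the sets reserved by
s1. Hence N(s1) and N(s3) both keep order dm vertices outside N(s2). *)
Lemma long_induced_cycle d m : regular G d -> 12 <= d -> sparse_overlap d ->
    well_joined -> 0 < m -> 48 * (d * m) <= #|G| -> #|G| <= 96 * (d * m) ->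
  exists2 k, m + 3 <= k & has_induced_cycle G k.
Proof.
move=> reg d12 sparse joined m0 md_le md_ge.
have m3 : 0 < 3 * m by rewrite muln_gt0.
have small : 16 * (d * (3 * m)) <= #|G|.
  by rewrite [d * _]mulnCA mulnA.
have [q [s [path ss large]]] := long_fresh_path reg d12 sparse m3 small.
pose s3 := take m s; pose s2 := take m (drop m s); pose s1 := drop (2 * m) s.
have sE : s = s3 ++ s2 ++ s1.
  by rewrite /s1 mul2n -addnn -drop_drop !cat_take_drop.
have sz3 : size s3 = m by rewrite size_takel // ss; lia.
have sz2 : size s2 = m by rewrite size_takel // size_drop ss; lia.
have sz1 : size s1 = m by rewrite size_drop ss; lia.
have us := fresh_path_uniq path.
have s3s : {subset s3 <= s} by move=> x xs; rewrite sE mem_cat xs.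
have s2s : {subset s2 <= s} by move=> x xs; rewrite sE !mem_cat xs orbT.
have s1s : {subset s1 <= s} by move=> x xs; rewrite sE !mem_cat xs !orbT.
have path21 : fresh_path q (s2 ++ s1).
  by move: path; rewrite {1}sE; elim: (s3) => //= v t IH /and4P[_ _ _ /IH].
have card_seq (t : seq G) : uniq t -> #|[set x in t]| = size t.
  by move=> /card_uniqP <-; rewrite cardsE.
have [u3 u2 u1] : [/\ uniq s3, uniq s2 & uniq s1].
  by split; rewrite ?take_uniq ?drop_uniq.
have fresh_union (t : seq G) : {subset t <= s} -> uniq t -> size t = m ->
    3 * (d * m) <= 4 * #|\bigcup_(v in [set x in t]) q v|.
  move=> ts ut <-; rewrite mulnA -(card_seq t) //.
  apply: leq_card_disjoint_bigcup => [v w|v]; rewrite !inE.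
    by move=> /ts vs /ts ws; apply: (fresh_path_sep path).
  by move=> /ts; apply: large.
have union_nbrs (t : seq G) : {subset t <= s} ->
    \bigcup_(v in [set x in t]) q v \subset nbrs [set x in t].
  move=> ts; apply/bigcupsP => v vt; apply: subset_trans (bigcup_sup v vt).
  by apply: (fresh_path_nbr path); apply: ts; move: vt; rewrite inE.
pose N2 := nbrs [set x in s2].
pose Z := ~: (N2 :|: [set x in s]).
pose A := nbrs [set x in s1] :&: Z; pose B := nbrs [set x in s3] :&: Z.
have cs : #|[set x in s]| = 3 * m by rewrite card_seq.
have d12m : 12 * m <= d * m by rewrite leq_mul2r d12 orbT.
have Zbig : 3 * #|G| <= 4 * #|Z|.
  have := cardsC (N2 :|: [set x in s]); rewrite -/Z => cZ.
  have c1 : #|N2 :|: [set x in s]| <= #|N2| + #|[set x in s]| by apply: leq_card_setU.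
  have := card_nbrs [set x in s2] reg; rewrite card_seq // sz2 -/N2.
  rewrite cs in c1; lia.
have inter_N2 : 4 * #|\bigcup_(v in [set x in s1]) q v :&: N2| <= d * m.
  have sub : \bigcup_(v in [set x in s1]) q v :&: N2 \subset
      \bigcup_(w in [set x in s2]) (nbr w :\: q w).
    apply/subsetP => x /setIP[/(subsetP (union_nbrs s1 s1s)) x1 /bigcupP[w ws xw]].
    apply/bigcupP; exists w => //; rewrite inE xw andbT.
    rewrite inE in ws; have dis := fresh_path_avoid path21 ws.
    by apply: contraTN x1 => /(disjointFr dis) ->.
  rewrite -[m]sz2 -(card_seq s2) // [d * _]mulnC -sum_nat_const.
  have := leq_trans (subset_leq_card sub) (leq_card_bigcup _ _).
  rewrite -(leq_pmul2l (isT : 0 < 4)) => /leq_trans; apply.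
  rewrite big_distrr /=; apply: leq_sum => w; rewrite inE => /s2s ws.
  have := large w ws; rewrite cardsD (setIidPr (fresh_path_nbr path ws)) reg; lia.
have capZ (t : seq G) : {subset t <= s} -> #|\bigcup_(v in [set x in t]) q v| <=
    #|nbrs [set x in t] :&: Z| + #|\bigcup_(v in [set x in t]) q v :&: N2| + 3 * m.
  move=> ts; rewrite -cs; set U := \bigcup_(v in _) q v.
  have sub : U \subset (nbrs [set x in t] :&: Z) :|: (U :&: N2) :|: [set x in s].
    apply/subsetP => x xU; have := subsetP (union_nbrs t ts) x xU.
    by rewrite !(in_setU, in_setI, in_setC) xU => ->; case: (x \in N2); case: (x \in [set x in s]).
  apply: leq_trans (subset_leq_card sub) _.
  apply: leq_trans (leq_card_setU _ _) _; rewrite leq_add2r.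
  exact: leq_card_setU.
have Abig : #|G| <= 384 * #|A|.
  have := capZ s1 s1s; have := fresh_union s1 s1s u1 sz1; rewrite -/A; lia.
have Bbig : #|G| <= 384 * #|B|.
  have := capZ s3 s3s; have := fresh_union s3 s3s u3 sz3; rewrite -/B.
  have -> : \bigcup_(v in [set x in s3]) q v :&: N2 = set0.
    apply: disjoint_setI0; rewrite disjoints_subset; apply/bigcupsP => v.
    rewrite inE -disjoints_subset => vs; rewrite sE in path.
    apply: disjointWr (fresh_path_avoid path vs); apply: nbrsS.
    by apply/subsetP => x; rewrite !inE mem_cat => ->.
  rewrite cards0; lia.
have G0 : 0 < #|G| by apply: leq_trans md_le; rewrite !muln_gt0 m0 (leq_trans _ d12).
have [x [p [xA yB up pZ pp]]] :=
  well_joined_path joined G0 Zbig (subsetIr _ _) (subsetIr _ _) Abig Bbig.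
have -> : m + 3 = 2 * m - m + 3 by lia.
move: xA yB; rewrite !in_setI => /andP[/bigcupP[v1 v1s xv] _] /andP[/bigcupP[v3 v3s yv] _].
rewrite !inE in v1s xv v3s yv.
apply: (@detour_cycle s x Z m (2 * m) us _ _ _ _ (index v1 s) (index v3 s) (x :: p)).
- by move=> i j; apply: fresh_path_adj path.
- rewrite disjoint_subset; apply/subsetP => z; rewrite !inE negb_or.
  by case/andP.
- move=> t z /andP[mt t2m].
  have tm : t - m < m by rewrite ltn_subLR // addnn -mul2n.
  rewrite !inE negb_or => /andP[zN _].
  apply: contra zN => tz; apply: mem_nbrs tz; rewrite inE.
  have -> : nth x s t = nth x s2 (t - m) by rewrite nth_take // nth_drop subnKC.
  by apply: mem_nth; rewrite sz2.
- by rewrite leq_pmull.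
have v1i : index v1 s < size s by rewrite index_mem s1s.
have v3i : index v3 s < size s by rewrite index_mem s3s.
split => //; last 2 first.
- by rewrite nth_index ?s1s.
- by rewrite nth_last nth_index ?s3s.
split; first by rewrite sE index_cat v3s -sz3 index_mem.
rewrite v1i andbT sE; move: us; rewrite sE !cat_uniq has_cat negb_or.
case/and5P=> _ /andP[_ /hasPn h3] _ /hasPn h2 _.
rewrite !index_cat (negbTE (h3 _ v1s)) (negbTE (h2 _ v1s)) sz3 sz2; lia.
Qed.
End Graph.

(** * From the mixing lemma to the theorem *)

Section Consequences.
Variables (R : realType) (G : sgraph) (d : nat).
Hypothesis d_gt0 : (0 < d)%N.
Hypothesis mixing : forall S T : {set G},
  ((\sum_(x in S) #|nbr x :&: T|)%:R - d%:R * #|S|%:R * #|T|%:R / #|G|%:R) ^+ 2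
    <= (d%:R / 128) ^+ 2 * #|S|%:R * #|T|%:R :> R.

Let dR_gt0 : 0 < d%:R :> R. Proof. by rewrite ltr0n. Qed.

(** B sends at least d|B|/4 edges to Q while the main term of the mixing lemma
is at most d|B|/8, so the error term is at least d|B|/8; 256 is 128^2/8^2. *)
Lemma mixing_sparse_overlap : sparse_overlap G d.
Proof.
move=> B Q small BQ; have [->|[x0 x0B]] := set_0Vmem B; first by rewrite cards0.
have b0 : 0 < #|B|%:R :> R by rewrite ltr0n card_gt0; apply/set0Pn; exists x0.
have n0 : 0 < #|G|%:R :> R by rewrite ltr0n; apply/card_gt0P; exists x0.
have edges : d%:R * #|B|%:R <= 4 * (\sum_(x in B) #|nbr x :&: Q|)%:R :> R.
  rewrite -!natrM ler_nat mulnC -sum_nat_const big_distrr /=; apply: leq_sum => x xB.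
  by have := subsetP BQ x xB; rewrite inE => /ltnW.
have density : d%:R * #|B|%:R * #|Q|%:R / #|G|%:R <= d%:R * #|B|%:R / 8 :> R.
  have : 8 * #|Q|%:R <= #|G|%:R :> R by rewrite -natrM ler_nat.
  by rewrite ler_pdivrMr // -!mulrA !ler_pM2l //; lra.
have := mixing B Q; set E := (\sum_(_ in _) _)%:R in edges *; set F := _ / _ in density *.
move=> mix; have : (d%:R * #|B|%:R / 8) ^+ 2 <= (E - F) ^+ 2.
  have db0 : 0 < d%:R * #|B|%:R :> R by rewrite mulr_gt0.
  by rewrite lerXn2r ?nnegrE //; lra.
move=> /le_trans/(_ mix) sq.
have : 256 * #|B|%:R <= #|Q|%:R :> R.
  rewrite -(ler_pM2l (mulr_gt0 (exprn_gt0 2 dR_gt0) b0)).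
  move: sq; rewrite !exprMn; lra.
by rewrite -natrM ler_nat.
Qed.

Lemma mixing_well_joined : well_joined G.
Proof.
move=> X Y noXY; have := mixing X Y; rewrite big1 ?sub0r ?sqrrN => [|x xX]; last first.
  apply/eqP; rewrite cards_eq0; apply/eqP/setP => y; rewrite !inE.
  by apply/negP => /andP[xy yY]; have := noXY x y xX yY; rewrite xy.
have [X0|x0] := posnP #|X|; first by rewrite X0.
have [Y0|y0] := posnP #|Y|; first by rewrite Y0 muln0.
have n0 : (0 < #|G|)%N by apply: leq_trans x0 (max_card _).
rewrite -(ler_nat R) natrX !natrM.
have [xR yR nR] : [/\ 0 < #|X|%:R :> R, 0 < #|Y|%:R :> R & 0 < #|G|%:R :> R].
  by rewrite !ltr0n.
move: #|X|%:R #|Y|%:R #|G|%:R xR yR nR => x y n xR yR nR.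
have [xy0 d2] : 0 < x * y /\ 0 < d%:R ^+ 2 :> R by rewrite mulr_gt0 ?exprn_gt0.
have -> : (d%:R * x * y / n) ^+ 2 = d%:R ^+ 2 * (x * y) * (x * y / n ^+ 2).
  by field; rewrite gt_eqF.
have -> : (d%:R / 128) ^+ 2 * x * y = d%:R ^+ 2 * (x * y) * 16384^-1 by field.
rewrite ler_pM2l ?mulr_gt0 // ler_pdivrMr ?exprn_gt0 //.
have : 0 <= n ^+ 2 by rewrite sqr_ge0.
by move: (n ^+ 2) => n2; lra.
Qed.

(** A vertex sends d edges to its d neighbours, far more than the main term
d^2/n, so the error term d^(3/2)/128 must be at least d/2. *)
Lemma mixing_degree_large : regular G d -> (0 < #|G|)%N -> (48 * d <= #|G|)%N ->
  (12 <= d)%N.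
Proof.
move=> reg /card_gt0P[x _] dn.
have := mixing [set x] (nbr x); rewrite big_set1 setIid reg cards1 !mulr1.
have n0 : 0 < #|G|%:R :> R by rewrite ltr0n; apply/card_gt0P; exists x.
have : d%:R * d%:R / #|G|%:R <= d%:R / 48 :> R.
  have : 48 * d%:R <= #|G|%:R :> R by rewrite -natrM ler_nat.
  by rewrite ler_pdivrMr // -!mulrA !ler_pM2l //; lra.
set F := _ / #|G|%:R => Fle mix.
have : (d%:R / 2) ^+ 2 <= (d%:R - F) ^+ 2.
  by have dR := dR_gt0; rewrite lerXn2r ?nnegrE //; lra.
move=> /le_trans/(_ mix); rewrite leqNgt => sq; apply/negP => d12.
have : d%:R <= 12 :> R by rewrite ler_nat ltnW.
rewrite -(ler_pM2l (exprn_gt0 2 dR_gt0)).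
have := exprn_gt0 2 dR_gt0; move: sq; rewrite !exprMn.
by move: (d%:R ^+ 2) => d2; lra.
Qed.
End Consequences.

Theorem theorem1 (R : realType) :
  exists delta1 delta2 delta3 : R,
    [/\ 0 < delta1, 0 < delta2, 0 < delta3 &
      forall (n d : nat) (lambda : R) (G : sgraph),
        (0 < n)%N -> (0 < d)%N ->
        ndlambda_graph n d lambda G ->
        d%:R <= delta3 * n%:R ->
        lambda / d%:R <= delta1 ->
        exists k : nat,
          has_induced_cycle G k /\ delta2 * n%:R / d%:R <= k%:R ].
Proof.
exists 128^-1, 96^-1, 48^-1; split=> [|||n d lambda G n0 d0 nd dn ld]; try lra.
have dR0 : 0 < d%:R :> R by rewrite ltr0n.
have [Gn reg [s _ lE]] := nd.
have l0 : 0 <= lambda by rewrite lE le_max normr_ge0.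
have ld' : lambda <= d%:R / 128 by move: ld; rewrite ler_pdivrMr // mulrC.
have mixing (S T : {set G}) :
    ((\sum_(x in S) #|nbr x :&: T|)%:R - d%:R * #|S|%:R * #|T|%:R / #|G|%:R) ^+ 2
      <= (d%:R / 128) ^+ 2 * #|S|%:R * #|T|%:R :> R.
  rewrite Gn; apply: le_trans (expander_mixing S T n0 nd _) _; first by lra.
  rewrite ler_wpM2r // ler_wpM2r // lerXn2r // nnegrE //; lra.
have dn' : (48 * d <= n)%N by rewrite -(ler_nat R) natrM; lra.
have d12 : (12 <= d)%N by apply: (mixing_degree_large d0 mixing reg); rewrite Gn.
have m0 : (0 < n %/ (48 * d))%N by rewrite divn_gt0 // muln_gt0.
have md_le : (48 * (d * (n %/ (48 * d))) <= #|G|)%N by rewrite mulnA mulnC Gn leq_trunc_div.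
have md_ge : (#|G| <= 96 * (d * (n %/ (48 * d))))%N.
  rewrite Gn; have := @ltn_ceil n (48 * d); rewrite muln_gt0 d0 => /(_ isT). nia.
have [k mk cyc] := long_induced_cycle reg d12 (mixing_sparse_overlap d0 mixing)
  (mixing_well_joined d0 mixing) m0 md_le md_ge.
exists k; split=> //; rewrite ler_pdivrMr // ler_pdivrMl //.
rewrite -!natrM ler_nat -Gn; apply: leq_trans md_ge _.
rewrite leq_mul2l /= mulnC leq_mul2r; apply/orP; right; lia.
Qed.
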